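(* Let $\mathrm{NU} = \mathcal{N} \rtimes \mathrm{SO}^+(3,1)$ be the Newman--Unti group, whose underlying topological space is the product $\mathcal{N} \times \mathrm{SO}^+(3,1)$, where $\mathcal{N}$ carries the subspace topology induced by the fine very strong topology on $C^\infty(\mathbb{R}\times \mathbb{S}^2,\mathbb{R})$ and $\mathrm{SO}^+(3,1)$ its usual Lie group topology. Then the unit component of $\mathrm{NU}$, i.e. the connected component of $\mathcal{N}\times \mathrm{SO}^+(3,1)$ containing the unit element $(p,\mathrm{id})$, coincides with $\mathrm{NU}_c = \mathcal{N}_c \times \mathrm{SO}^+(3,1)$.
   Context: $\mathbb{S}^2$ is the 2-sphere, and $C^\infty(\mathbb{R}\times\mathbb{S}^2) = C^\infty(\mathbb{R}\times\mathbb{S}^2,\mathbb{R})$ is the set of smooth real-valued functions. $\mathrm{Diff}^+(\mathbb{R})$ is the group of smooth orientation-preserving diffeomorphisms of $\mathbb{R}$ (smooth diffeomorphisms $\mathbb{R}\to\mathbb{R}$ with everywhere positive derivative). $\mathrm{SO}^+(3,1)$ is the orthochronous Lorentz group, a connected finite-dimensional Lie group. Define $\mathcal{N} = \{F \in C^\infty(\mathbb{R}\times\mathbb{S}^2) \mid F(\cdot,\mathbf{z}) \in \mathrm{Diff}^+(\mathbb{R}) \text{ for all } \mathbf{z}\in\mathbb{S}^2\}$. It is a group with product $(F\cdot G)(u,\mathbf{z}) = F(G(u,\mathbf{z}),\mathbf{z})$, unit $p\colon \mathbb{R}\times\mathbb{S}^2\to\mathbb{R}$, $p(t,\mathbf{z})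 = t$, and inverse $F^{-1}(\cdot,\mathbf{z}) = F(\cdot,\mathbf{z})^{-1}$. Define $\mathcal{N}_c = \{F\in\mathcal{N} \mid \exists K\subseteq \mathbb{R}\times\mathbb{S}^2 \text{ compact such that } F(t,\mathbf{z}) = t \text{ for all } (t,\mathbf{z})\notin K\}$. The Newman--Unti group is a semidirect product $\mathcal{N}\rtimes \mathrm{SO}^+(3,1)$; its unit is $(p,\mathrm{id})$, and topologically it is the product of the two factors. Only the underlying topological space and the unit element enter the claim. Fine very strong topology on $C^\infty(X,\mathbb{R})$ for a finite-dimensional (second countable, Hausdorff) smooth manifold $X$: The very strong topology has as a basis the sets consisting of all $h\in C^\infty(X,\mathbb{R})$ such that for all $i\in I$ and all $0\le k\le r_i$, $\sup_{a\in A_i}\|D^{k}(h\circ\varphi_i^{-1})(\varphi_i(a)) - D^{k}(f\circ\varphi_i^{-1})(\varphi_i(a))\| < \varepsilon_i$; here $f\in C^\infty(X,\mathbb{R})$, $(A_i)_{i\in I}$ is any locally finite family of compact subsets of $X$, each $A_i$ is contained in the domain of a chart $(U_i,\varphi_i)$ of $X$, and $r_i\in\mathbb{N}_0$, $\varepsilon_i>0$ are arbitrary for each $i\in I$. The fine very strong topology is the coarsest topology which is finer than the very strong topology and for which every set $\{h\in C^\infty(X,\mathbb{R}) \mid \{x\in X: h(x)\neq f(x)\} \text{ is contained in a compact subset of } X\}$, $f\in C^\infty(X,\mathbb{R})$, is open. *)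

(* Defs.v *)
From HB Require Import structures.
From mathcomp Require Import all_boot all_order all_algebra.
From mathcomp Require Import all_classical all_reals all_analysis.
From mathcomp Require Import ring lra.

Set Implicit Arguments.
Unset Strict Implicit.
Unset Printing Implicit Defensive.

Import Order.TTheory GRing.Theory Num.Theory.
Import numFieldNormedType.Exports.

Local Open Scope classical_set_scope.
Local Open Scope ring_scope.

Section smooth_maps.
Context {R : realType} {V W : normedModType R}.

(* iter_derive [:: v1; ...; vk] f x = D^k f(x)(v1, ..., vk) *)
Definition iter_derive (s : seq V) (f : V -> W) : V -> W :=
  foldr (fun v g => 'D_v g) f s.

(* C^oo on the set A, meant for A open and V finite-dimensional: there, f is
   smooth iff all its iterated directional derivatives are differentiable. *)
Definition smooth_on (A : set V) (f : V -> W) : Prop :=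
  forall (s : seq V) (x : V), A x -> differentiable (iter_derive s f) x.

Lemma iter_derive_linear (f : {linear V -> W}) (s : seq V) :
  continuous f ->
  iter_derive s f = f \/ exists c, iter_derive s f = cst c.
Proof.
move=> fc; elim: s => [|v s [IH|[c IH]]] /=; first by left.
  right; exists (f v); rewrite IH; apply/funext => x.
  by rewrite deriveE ?diff_lin //; exact: linear_differentiable.
right; exists 0; rewrite IH; apply/funext => x.
by rewrite derive_cst.
Qed.

Lemma smooth_on_linear (A : set V) (f : {linear V -> W}) :
  continuous f -> smooth_on A f.
Proof.
move=> fc s x _; have [->|[c ->]] := iter_derive_linear s fc.
  exact: linear_differentiable.
exact: differentiable_cst.
Qed.

Lemma near_eq_differentiable (f g : V -> W) (x : V) :
  (\near x, f x = g x) -> differentiable f x -> differentiable g x.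
Proof.
move=> fg df; have [dfc /eqaddoP dfx] := (diff_locallyP _ _).1 df.
have dgx : g \o shift x = cst (g x) + 'd f x +o_ 0 id.
  have fg0 : \forall y \near 0, f (y + x) = g (y + x).
    by move: fg; rewrite (near_shift 0) subr0.
  apply/eqaddoP => eps eps0; apply: filterS2 fg0 (dfx _ eps0).
  move=> y /= fgy; rewrite !fctE /= fgy.
  by rewrite (nbhs_singleton fg).
have dgE := diff_unique dfc dgx.
by apply/diff_locallyP; rewrite dgE.
Qed.

End smooth_maps.

Section smooth_comp.
Context {R : realType} {V W U : normedModType R}.

Lemma smooth_on_comp_linear (A : set V) (f : V -> W) (l : {linear W -> U}) :
  continuous l -> open A -> smooth_on A f -> smooth_on A (l \o f).
Proof.
move=> lc oA sf.
have lf s x : A x -> iter_derive s (l \o f) x = l (iter_derive s f x).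
  elim: s x => [//|v s IH] x Ax /=.
  have dl y : differentiable l y by exact: linear_differentiable.
  rewrite (@near_eq_derive _ _ _ _ (l \o iter_derive s f)); last first.
    by near=> y; apply: IH; near: y; exact: open_nbhs_nbhs.
  rewrite deriveE; last by apply: differentiable_comp; [exact: sf|exact: dl].
  rewrite diff_comp ?diff_lin //=; last exact: sf.
  by rewrite -deriveE //; exact: sf.
move=> s x Ax; apply: (@near_eq_differentiable _ _ _ (l \o iter_derive s f)).
  by near=> y; rewrite lf//; near: y; exact: open_nbhs_nbhs.
apply: differentiable_comp; [exact: sf|exact: linear_differentiable].
Unshelve. all: by end_near. Qed.

End smooth_comp.

Section manifolds.
Context {R : realType} {n : nat} {M : topologicalType}.

(* A coordinate system phi : U -> R^n, U `<=` M, together with phi^-1. The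
   values of chart_fun outside U and of chart_inv outside phi(U) are junk. *)
Record chart := Chart {
  chart_dom : set M;
  chart_fun :> M -> 'rV[R]_n;
  chart_inv : 'rV[R]_n -> M }.

Definition chart_codom (c : chart) : set 'rV[R]_n := c @` chart_dom c.

Definition is_topological_chart (c : chart) : Prop :=
  [/\ open (chart_dom c), open (chart_codom c),
      {in chart_dom c, cancel c (chart_inv c)},
      {within chart_dom c, continuous c} &
      {within chart_codom c, continuous (chart_inv c)}].

Definition smooth_transition (c d : chart) : Prop :=
  smooth_on (c @` (chart_dom c `&` chart_dom d)) (d \o chart_inv c).

(* The charts of the manifold are those of the maximal atlas generated by the
   atlas A. *)
Definition maximal_atlas (A : set chart) : set chart :=
  [set c | is_topological_chart c /\
           forall d, A d -> smooth_transition c d /\ smooth_transition d c].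

Definition locally_finite (I : Type) (K : I -> set M) : Prop :=
  forall x : M, exists2 U, nbhs x U & finite_set [set i | K i `&` U !=set0].

Definition is_smooth (A : set chart) (h : M -> R) : Prop :=
  forall c, maximal_atlas A c -> smooth_on (chart_codom c) (h \o chart_inv c).

Record smooth_fun (A : set chart) := SmoothFun {
  smooth_fun_val :> M -> R;
  smooth_funP : is_smooth A smooth_fun_val }.

(* operator norm of a k-linear map *)
Definition multilinear_norm (k : nat) (T : k.-tuple 'rV[R]_n -> R) : \bar R :=
  ereal_sup [set `|T v|%:E | v in [set v | forall i, `|tnth v i| <= 1]].

(* D^k (h o phi^-1) (phi a) *)
Definition chart_derivative (k : nat) (h : M -> R) (c : chart) (a : M)
    (v : k.-tuple 'rV[R]_n) : R :=
  iter_derive v (h \o chart_inv c) (c a).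

(* sup_{a in K} || D^k (h o phi^-1)(phi a) - D^k (f o phi^-1)(phi a) || *)
Definition chart_dist (k : nat) (c : chart) (K : set M) (h f : M -> R) :
    \bar R :=
  ereal_sup [set multilinear_norm (fun v : k.-tuple 'rV[R]_n =>
                   chart_derivative h c a v - chart_derivative f c a v)
            | a in K].

Section function_space.
Variable A : set chart.

Definition very_strong_basic (f : smooth_fun A) (I : Type) (K : I -> set M)
    (phi : I -> chart) (r : I -> nat) (e : I -> R) : set (smooth_fun A) :=
  [set h | forall (i : I) (k : nat), (k <= r i)%N ->
     (chart_dist k (phi i) (K i) h f < (e i)%:E)%E].

Definition very_strong_basis : set (set (smooth_fun A)) :=
  [set B | exists (f : smooth_fun A) (I : Type) (K : I -> set M)
             (phi : I -> chart) (r : I -> nat) (e : I -> R),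
     [/\ locally_finite K,
         forall i, compact (K i),
         forall i, maximal_atlas A (phi i) /\ K i `<=` chart_dom (phi i),
         forall i, 0 < e i &
         B = very_strong_basic f K phi r e]].

Definition very_strong_open (O : set (smooth_fun A)) : Prop :=
  forall f, O f -> exists B, [/\ very_strong_basis B, B f & B `<=` O].

Definition compactly_equal_class (f : smooth_fun A) : set (smooth_fun A) :=
  [set h | exists2 C : set M, compact C & [set x | h x <> f x] `<=` C].

Definition fine_very_strong_subbase : set (set (smooth_fun A)) :=
  [set O | very_strong_open O \/ exists f, O = compactly_equal_class f].

HB.instance Definition _ := gen_eqMixin (smooth_fun A).
HB.instance Definition _ := gen_choiceMixin (smooth_fun A).
(* the fine very strong topology: the coarsest one in which the members of the
   subbase are open *)
HB.instance Definition _ :=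
  isSubBaseTopological.Build (smooth_fun A) fine_very_strong_subbase id.

End function_space.

End manifolds.

Arguments chart R n M : clear implicits.

Section cylinder.
Variable R : realType.

Definition sphere : set 'rV[R]_3 := [set z | \sum_i z 0 i ^+ 2 = 1].

Definition S2 : topologicalType := set_type sphere.

Definition cylinder : topologicalType := (R * S2)%type.

(* inverse of the stereographic projection from the pole (0, 0, e), e ^+ 2 = 1,
   onto the plane z_2 = 0 *)
Definition stereo_inv_val (e y0 y1 : R) : 'rV[R]_3 :=
  let q := y0 ^+ 2 + y1 ^+ 2 in
  \row_i [:: 2 * y0 / (q + 1); 2 * y1 / (q + 1); e * (q - 1) / (q + 1)]`_i.

Lemma stereo_inv_sphere (b : bool) (y0 y1 : R) :
  stereo_inv_val ((-1) ^+ b) y0 y1 \in sphere.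
Proof.
rewrite inE /sphere /= !big_ord_recl big_ord0 /stereo_inv_val !mxE /=.
have q1 : y0 ^+ 2 + y1 ^+ 2 + 1 != 0.
  by rewrite gt_eqF // ltr_wpDl // addr_ge0 // sqr_ge0.
rewrite !exprMn sqrr_sign; field.
exact: q1.
Qed.

Definition stereo_inv (b : bool) (y0 y1 : R) : S2 :=
  exist (fun z => z \in sphere) _ (stereo_inv_sphere b y0 y1).

(* (t, z) |-> (t, stereographic projection of z from the pole
   (0, 0, (-1) ^+ b)) *)
Definition cylinder_chart (b : bool) : chart R 3 cylinder :=
  let e := (-1) ^+ b in
  {| chart_dom := [set x : cylinder | (\val x.2 : 'rV[R]_3) 0 2 != e];
     chart_fun := fun x : cylinder =>
       let z : 'rV[R]_3 := \val x.2 in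
       \row_i [:: x.1; z 0 0 / (1 - e * z 0 2); z 0 1 / (1 - e * z 0 2)]`_i;
     chart_inv := fun y => (y 0 0, stereo_inv b (y 0 1) (y 0 2)) |}.

Definition cylinder_atlas : set (chart R 3 cylinder) := range cylinder_chart.

Lemma open_cylinder_chart_dom (b : bool) : open (chart_dom (cylinder_chart b)).
Proof.
have vc : continuous (fun x : cylinder => (\val x.2 : 'rV[R]_3) 0 2).
  move=> x.
  have vc : continuous (set_val : S2 -> 'rV[R]_3) by exact: initial_continuous.
  have cc := @coord_continuous R 1 3 0 2.
  exact: (continuous_comp (continuous_comp (@cvg_snd _ _ _ _ _) (vc _)) (cc _)).
have -> : chart_dom (cylinder_chart b) =
    (fun x : cylinder => (\val x.2 : 'rV[R]_3) 0 2) @^-1`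
      (~` [set (-1) ^+ b]).
  by apply/seteqP; split => x /= /eqP.
apply: open_comp; first by move=> x _; exact: vc.
by rewrite openC; exact: closed_eq.
Qed.

Lemma open_chart_image (n : nat) (M : topologicalType) (c d : chart R n M) :
  is_topological_chart c -> open (chart_dom d) ->
  open (c @` (chart_dom c `&` chart_dom d)).
Proof.
move=> [_ oc ck _ ic] od.
move: ic; rewrite continuous_open_subspace // => ic.
rewrite openE => _ [x [cx dx] <-]; rewrite /interior.
have cdx : chart_codom c (c x) by exists x.
have icx : {for c x, continuous (chart_inv c)} by apply: ic; rewrite inE.
have near_d : \forall y \near c x, chart_dom d (chart_inv c y).
  by apply: icx; rewrite ck ?inE //; exact: open_nbhs_nbhs.
have near_c : \forall y \near c x, chart_codom c y by exact: open_nbhs_nbhs.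
apply: filterS2 near_d near_c => y dy [w cw wy]; exists w => //; split => //.
by rewrite -(ck w) ?inE // wy.
Qed.

Lemma smooth_time : is_smooth cylinder_atlas (fst : cylinder -> R).
Proof.
move=> c [ctop ccomp] s x [y cy <-].
have [b yb] : exists b, chart_dom (cylinder_chart b) y.
  have [y1|y1] := eqVneq ((\val y.2 : 'rV[R]_3) 0 2) 1.
    by exists true; rewrite /= y1 expr1 eq_sym lt_eqF // ltrN10.
  by exists false; rewrite /= expr0.
have [sm _] := ccomp (cylinder_chart b) (ex_intro2 _ _ b I erefl).
have oA := open_chart_image ctop (@open_cylinder_chart_dom b).
have @l : {linear 'rV[R]_3 -> R}.
  by exists (fun N : 'rV[R]_3 => N 0 0); do 2![eexists]; do ?[constructor];
     rewrite ?mxE// => ? *; rewrite ?mxE//; move=> ?; rewrite !mxE.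
have -> : fst \o chart_inv c = l \o (cylinder_chart b \o chart_inv c).
  by apply/funext => w /=; rewrite mxE.
apply: (smooth_on_comp_linear _ oA sm); first exact: coord_continuous.
by exists y.
Qed.

(* C^oo(R x S^2, R) with the fine very strong topology *)
Definition smooth_cylinder : topologicalType := smooth_fun cylinder_atlas.

Definition time : smooth_cylinder := SmoothFun smooth_time.

(* Diff^+(R) *)
Definition orientation_diffeo : set (R -> R) :=
  [set g : R -> R |
    [/\ smooth_on setT g,
        exists g' : R -> R, [/\ smooth_on setT g', cancel g g' & cancel g' g] &
        forall t, 0 < g^`()%classic t]].

Definition nu_normal_set : set smooth_cylinder :=
  [set F | forall z : S2, orientation_diffeo (fun u => F (u, z))].

Definition nu_normal : topologicalType := set_type nu_normal_set.

Lemma time_nu_normal : time \in nu_normal_set.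
Proof.
rewrite inE => z.
have sid : smooth_on setT (idfun : R -> R).
  by apply: smooth_on_linear => x; exact: cvg_id.
split => /=; first exact: sid.
- by exists idfun.
- by move=> t; rewrite derive1E derive_id.
Qed.

Definition nu_normal_unit : nu_normal :=
  exist (fun F => F \in nu_normal_set) time time_nu_normal.

Definition nu_normal_c : set nu_normal :=
  [set F | exists2 K : set cylinder, compact K &
     forall x, ~ K x -> (\val F : smooth_cylinder) x = x.1].

(* coordinates 0, 1, 2 are spatial, coordinate 3 is time *)
Definition minkowski : 'M[R]_4 :=
  \matrix_(i, j) if i == j then (if i == 3 then -1 else 1) else 0.

Definition lorentz_set : set 'M[R]_4 :=
  [set L | [/\ L^T *m minkowski *m L = minkowski, \det L = 1 & 0 < L 3 3]].

Definition lorentz : topologicalType := set_type lorentz_set.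

Lemma lorentz_id : 1%:M \in lorentz_set.
Proof. by rewrite inE; split; rewrite ?trmx1 ?mul1mx ?mulmx1 ?det1 ?mxE. Qed.

Definition lorentz_unit : lorentz :=
  exist (fun L => L \in lorentz_set) 1%:M lorentz_id.

(* N x SO^+(3,1) with the product topology; the group law plays no role here *)
Definition newman_unti : topologicalType := (nu_normal * lorentz)%type.

Definition newman_unti_unit : newman_unti := (nu_normal_unit, lorentz_unit).

Definition newman_unti_c : set newman_unti := nu_normal_c `*` setT.

End cylinder.

Arguments sphere R : clear implicits.
Arguments cylinder_atlas R : clear implicits.
Arguments nu_normal_set R : clear implicits.
Arguments nu_normal_c R : clear implicits.
Arguments lorentz_set R : clear implicits.
Arguments newman_unti_c R : clear implicits.

(* Main.v *)
Require Import Defs.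
From HB Require Import structures.
From mathcomp Require Import all_boot all_order all_algebra.
From mathcomp Require Import all_classical all_reals all_analysis.
From mathcomp Require Import ring lra.

(** Write [p] for the projection to time.  The functions that differ from a
    given [f] only inside a compact set form a class; the fine very strong
    topology makes these classes open, and they partition the function space,
    so each of them is also closed.  The class of [p] cuts out [nu_normal_c],
    hence a connected set through the unit never leaves
    [nu_normal_c `*` setT].

    Conversely, an [F] in [nu_normal_c] is joined to [p] by the straight segment
    [s |-> p + s (F - p)].

    - The segment stays among the fibrewise diffeomorphisms: the derivative
      [(1 - s) + s F'] is positive, a convex combination of the identity with an
      increasing bijection is onto, and the inverse of a smooth bijection with
      positive derivative is smooth ([orientation_diffeo_segment],
      [smooth_inverse]).
    - The segment is continuous because [F - p] has compact support: in a very
      strong basic neighbourhood, given by a locally finite family of compact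
      sets, only the finitely many members that meet this support constrain
      [s]; on each of them the derivatives of [F - p] in the chart are bounded,
      so that moving [s] a little changes the seminorms only a little
      ([continuous_segment]).

    The Lorentz factor is connected ([lorentz_connected]): rotations and a
    boost acting on the rows of a matrix along one-parameter paths bring it to
    the identity column by column.  Along such a path the determinant and the
    time-time entry never vanish, so their signs are preserved. *)

Set Implicit Arguments.
Unset Strict Implicit.
Unset Printing Implicit Defensive.

Import Order.TTheory GRing.Theory Num.Theory.
Import numFieldNormedType.Exports.

Local Open Scope classical_set_scope.
Local Open Scope ring_scope.

(** * Iterated directional derivatives *)

Section iterated_derivatives.
Context {R : realType} {V W : normedModType R}.
Implicit Types (A : set V) (f g : V -> W).

Lemma iter_derive_rcons (s : seq V) v f :
  iter_derive (rcons s v) f = iter_derive s ('D_v f).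
Proof. by rewrite /iter_derive foldr_rcons. Qed.

Lemma eq_iter_derive A f g (s : seq V) : open A ->
  (forall x, A x -> f x = g x) ->
  forall x, A x -> iter_derive s f x = iter_derive s g x.
Proof.
move=> oA fg; elim: s => [//|v s IH] x Ax /=.
apply: near_eq_derive; near=> y; apply: IH.
by near: y; exact: open_nbhs_nbhs.
Unshelve. all: by end_near. Qed.

Lemma smooth_on_derive A f v : smooth_on A f -> smooth_on A ('D_v f).
Proof. by move=> sf s x Ax; rewrite -iter_derive_rcons; exact: sf. Qed.

Lemma iter_deriveDZ A f g a (s : seq V) : open A ->
  smooth_on A f -> smooth_on A g -> forall x, A x ->
  iter_derive s (fun y => f y + a *: g y) x =
  iter_derive s f x + a *: iter_derive s g x.
Proof.
move=> oA sf sg; elim: s => [//|v s IH] x Ax /=.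
have df : derivable (iter_derive s f) x v by apply: diff_derivable; exact: sf.
have dg : derivable (iter_derive s g) x v by apply: diff_derivable; exact: sg.
rewrite -(deriveZ a dg) -deriveD //; last exact: derivableZ.
apply: near_eq_derive; near=> y; apply: IH.
by near: y; exact: open_nbhs_nbhs.
Unshelve. all: by end_near. Qed.

Lemma smooth_onDZ A f g a : open A -> smooth_on A f -> smooth_on A g ->
  smooth_on A (fun y => f y + a *: g y).
Proof.
move=> oA sf sg s x Ax.
apply: (@near_eq_differentiable _ _ _
  (iter_derive s f + (a \*: iter_derive s g))); last first.
  by apply: differentiableD; [exact: sf|apply: differentiableZ; exact: sg].
near=> y; apply/esym/(iter_deriveDZ _ _ oA) => //.
by near: y; exact: open_nbhs_nbhs.
Unshelve. all: by end_near. Qed.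

Lemma iter_derive0 (s : seq V) : iter_derive s (cst 0 : V -> W) = cst 0.
Proof.
by elim: s => [//|v s IH] /=; rewrite IH; apply/funext => y; rewrite derive_cst.
Qed.

Lemma smooth_on_cst A (c : W) : smooth_on A (cst c).
Proof.
move=> s x _.
suff [d ->] : exists d, iter_derive s (cst c) = cst d.
  exact: differentiable_cst.
elim: s => [|v s [d IH]] /=; first by exists c.
by exists 0; rewrite IH; apply/funext => y; rewrite derive_cst.
Qed.

End iterated_derivatives.

Section bounds_on_compact_sets.
Context {R : realType} {n : nat}.
Implicit Types (A K : set 'rV[R]_n) (f : 'rV[R]_n -> R).

Lemma iter_derive_lincomb A I (r : seq I) (a : I -> R)
    (g : I -> 'rV[R]_n -> R) (s : seq 'rV[R]_n) :
  open A -> (forall i, smooth_on A (g i)) -> forall x, A x ->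
  smooth_on A (fun y => \sum_(i <- r) a i *: g i y) /\
  iter_derive s (fun y => \sum_(i <- r) a i *: g i y) x =
  \sum_(i <- r) a i *: iter_derive s (g i) x.
Proof.
move=> oA sg x Ax; elim: r => [|i r [IH1 IH2]].
  have -> : (fun y => \sum_(i <- [::]) a i *: g i y) = cst 0.
    by apply/funext => y; rewrite big_nil.
  by split; [exact: smooth_on_cst|rewrite big_nil iter_derive0].
have -> : (fun y => \sum_(j <- i :: r) a j *: g j y) =
    fun y => \sum_(j <- r) a j *: g j y + a i *: g i y.
  by apply/funext => y; rewrite big_cons addrC.
split; first exact: smooth_onDZ.
by rewrite (iter_deriveDZ _ _ oA) // IH2 big_cons addrC.
Qed.

(** By linearity in the innermost direction [v], the functions
    [iter_derive (rcons s v) f] are combinations, with coefficients in [-1, 1],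
    of the [iter_derive s] of the partial derivatives of [f]; this reduces the
    bound to the continuity of finitely many functions on [K]. *)
Lemma iter_derive_bounded A K f k : open A -> compact K -> K `<=` A ->
  smooth_on A f ->
  exists2 M : R, 0 <= M & forall x (s : seq 'rV[R]_n), K x -> size s = k ->
    (forall v, v \in s -> `|v| <= 1) -> `|iter_derive s f x| <= M.
Proof.
move=> oA cK KA; elim: k f => [|k IH] f sf.
  have cfK : compact (f @` K).
    apply: continuous_compact => //; apply: continuous_in_subspaceT => x.
    rewrite inE => /KA Ax; apply: differentiable_continuous.
    exact: (sf [::]).
  have [B [_ /(_ (B + 1)) H]] := compact_bounded cfK.
  exists `|B + 1| => // x s Kx /size0nil -> _ /=.
  apply: (le_trans _ (ler_norm _)); apply: H; first by rewrite ltrDl.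
  by exists x.
pose e i : 'rV[R]_n := delta_mx 0 i.
have /choice[M HM] : forall i, exists M : R, 0 <= M /\
    forall x (s : seq 'rV[R]_n), K x -> size s = k ->
    (forall v, v \in s -> `|v| <= 1) -> `|iter_derive s ('D_(e i) f) x| <= M.
  move=> i; have [M M0 HM] := IH _ (smooth_on_derive (e i) sf).
  by exists M; split.
exists (\sum_i M i); first by apply: sumr_ge0 => i _; have [] := HM i.
move=> x s Kx; elim/last_ind: s => [//|s v _].
rewrite size_rcons => -[sk] sv; rewrite iter_derive_rcons.
rewrite (@eq_iter_derive _ _ _ A _ (fun y => \sum_i v 0 i *: 'D_(e i) f y)) //;
  last 2 first.
- move=> y Ay; have df : differentiable f y by exact: (sf [::]).
  rewrite deriveE // {1}(row_sum_delta v) linear_sum.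
  by apply: eq_bigr => i _; rewrite linearZ /= deriveE.
- exact: KA.
have [|_ ->] := @iter_derive_lincomb A _ (index_enum _) (fun i => v 0 i)
    (fun i => 'D_(e i) f) s oA _ x (KA x Kx).
  by move=> i; exact: smooth_on_derive.
apply: (le_trans (ler_norm_sum _ _ _)); apply: ler_sum => i _.
rewrite normrM -[leRHS]mul1r ler_pM //.
- apply: le_trans (sv v _); last by rewrite mem_rcons mem_head.
  rewrite [leRHS]mx_normrE.
  exact: (le_bigmax _ (fun ij => `|v ij.1 ij.2|) (0, i)).
- by apply: (HM i).2 => // w ws; apply: sv; rewrite mem_rcons inE ws orbT.
Qed.

End bounds_on_compact_sets.

(** * Smooth bijections of the line *)

Section real_line.
Context {R : realType}.
Implicit Types f g h : R -> R.

(** On the line, differentiating along [1] only leads to the usual classes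
    [C^k], for which the product, inverse and chain rules are inductions
    on [k]. *)
Fixpoint classC (k : nat) f : Prop :=
  if k is j.+1 then (forall x, derivable f x 1) /\ classC j ('D_1 f)
  else continuous f.

Lemma classCW k f : classC k.+1 f -> classC k f.
Proof.
elim: k f => [f [df _] x|k IH f [df /IH rf]]; last by split.
by apply: differentiable_continuous; apply/derivable1_diffP.
Qed.

Lemma derive_direction (f : R -> R) v x :
  derivable f x 1 -> 'D_v f x = v * 'D_1 f x.
Proof.
move=> /derivable1_diffP df; rewrite !deriveE // -{1}(mulr1 v).
by rewrite -[LHS]/('d f x (v *: 1)) linearZ.
Qed.

Lemma classCD k f g : classC k f -> classC k g -> classC k (f + g).
Proof.
elim: k f g => [|k IH] f g.
  by move=> cf cg x; apply: cvgD; [exact: cf|exact: cg].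
move=> [df rf] [dg rg]; split; first by move=> x; exact: derivableD.
have -> : 'D_1 (f + g) = 'D_1 f + 'D_1 g by apply/funext => x; rewrite deriveD.
exact: IH.
Qed.

Lemma classCM k f g : classC k f -> classC k g -> classC k (f * g).
Proof.
elim: k f g => [|k IH] f g.
  by move=> cf cg x; apply: cvgM; [exact: cf|exact: cg].
move=> rf rg; have [[df rf'] [dg rg']] := (rf, rg).
split; first by move=> x; exact: derivableM.
have -> : 'D_1 (f * g) = f * 'D_1 g + g * 'D_1 f.
  by apply/funext => x; rewrite deriveM.
by apply: classCD; apply: IH => //; exact: classCW.
Qed.

Lemma classC_cst k (c : R) : classC k (cst c).
Proof.
elim: k c => [c x|k IH c]; first exact: cvg_cst.
split; first by move=> x; exact: derivable_cst.
rewrite (_ : 'D_1 (cst c : R -> R) = cst 0) //.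
by apply/funext => x; rewrite derive_cst.
Qed.

Lemma classCV k f : (forall x, f x != 0) -> classC k f ->
  classC k (fun x => (f x)^-1).
Proof.
move=> f0; elim: k => [cf x|k IH rf]; first by apply: cvgV => //; exact: cf.
have [df rf'] := rf; split; first by move=> x; exact: derivableV.
have -> : 'D_1 (fun x => (f x)^-1) =
    cst (- 1) * ((fun x => (f x)^-1) * (fun x => (f x)^-1) * 'D_1 f).
  apply/funext => x; rewrite deriveV // !fctE /=.
  by rewrite -[LHS]/(- (f x) ^- 2 * 'D_1 f x) expr2 invfM mulN1r mulNr.
have rV := IH (classCW rf).
apply: classCM; first exact: classC_cst.
by apply: classCM => //; exact: classCM.
Qed.

Lemma classC_comp k f g : classC k f -> classC k g -> classC k (f \o g).
Proof.
elim: k f g => [f g cf cg x|k IH f g rf rg].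
  by apply: continuous_comp; [exact: cg|exact: cf].
have [[df rf'] [dg rg']] := (rf, rg).
have dfg x : differentiable (f \o g) x.
  by apply: differentiable_comp; apply/derivable1_diffP.
split; first by move=> x; apply/derivable1_diffP.
have -> : 'D_1 (f \o g) = ('D_1 f \o g) * 'D_1 g.
  apply/funext => x; have := derive1_comp (dg x) (df (g x)).
  by rewrite !derive1E.
by apply: classCM => //; apply: IH => //; exact: classCW.
Qed.

Lemma smooth_on_classC f : smooth_on setT f <-> forall k, classC k f.
Proof.
split=> [sf k|rf s x _].
  elim: k f sf => [f sf x|k IH f sf].
    by apply: differentiable_continuous; exact: (sf [::]).
  split; last by apply: IH; exact: smooth_on_derive.
  by move=> x; apply/derivable1_diffP; exact: (sf [::]).
elim/last_ind: s f rf => [f rf|s v IH f rf] /=.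
  by apply/derivable1_diffP; have [] := rf 1%N.
rewrite iter_derive_rcons; apply: IH => k; have [df rf'] := rf k.+1.
have -> : 'D_v f = cst v * 'D_1 f.
  by apply/funext => y; rewrite derive_direction.
by apply: classCM => //; exact: classC_cst.
Qed.

(** The derivative of [h] is [1 / (g' o h)], so if [h] is [C^k] then its
    derivative is [C^k], and [h] is [C^(k+1)]. *)
Lemma smooth_inverse g h : smooth_on setT g -> (forall t, 0 < 'D_1 g t) ->
  cancel g h -> cancel h g -> smooth_on setT h.
Proof.
move=> /smooth_on_classC rg dg gh hg; apply/smooth_on_classC => k.
have [dvg _] := rg 1%N.
have dh (y : R) : is_derive y 1 h ('D_1 g (h y))^-1.
  rewrite -{1}(hg y); apply: is_derive_inverse.
  - by near=> z; exact: gh.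
  - by near=> z; apply: differentiable_continuous; apply/derivable1_diffP.
  - exact/derivableP.
  - by rewrite gt_eqF.
have hE : 'D_1 h = fun y => (('D_1 g \o h) y)^-1.
  by apply/funext => y; have [_ ->] := dh y.
elim: k => [y|k IH].
  apply: differentiable_continuous; apply/derivable1_diffP.
  by have [] := dh y.
split; first by move=> y; have [] := dh y.
rewrite hE; apply: classCV; first by move=> x; rewrite gt_eqF //; exact: dg.
apply: classC_comp; last exact: IH.
exact: (rg k.+1).2.
Unshelve. all: by end_near. Qed.

End real_line.

Section segment_of_diffeos.
Context {R : realType}.
Implicit Types g h : R -> R.

Lemma derivative_gt0_lt g : (forall t, derivable g t 1) ->
  (forall t, 0 < 'D_1 g t) -> forall x y, x < y -> g x < g y.
Proof.
move=> dg pg x y xy.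
have [||c _ E] := @MVT R g ('D_1 g) x y xy.
- by move=> z _; exact: derivableP.
- apply: continuous_subspaceT => z; apply: differentiable_continuous.
  exact/derivable1_diffP.
- by rewrite -subr_gt0 E mulr_gt0 // subr_gt0.
Qed.

(** The derivative [(1 - s) + s g'] is positive, and the map takes values on
    both sides of [y] at the smaller and the larger of [y] and [g^-1 y]. *)
Lemma orientation_diffeo_segment g (s : R) : 0 <= s <= 1 ->
  orientation_diffeo g -> orientation_diffeo (fun t => t + s *: (g t - t)).
Proof.
move=> /andP[s0 s1] [sg [g' [_ gK g'K]] pg].
have {}pg t : 0 < 'D_1 g t by rewrite -derive1E.
have dg t : derivable g t 1 by apply/derivable1_diffP; exact: (sg [::]).
have incg := derivative_gt0_lt dg pg.
set f := fun t => _.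
have sid : smooth_on setT (idfun : R -> R).
  by apply: smooth_on_linear => x; exact: cvg_id.
have sf : smooth_on setT f.
  have -> : f = fun t => idfun t + s *: (g t + (- 1) *: idfun t).
    by apply/funext => t; rewrite /f scaleN1r.
  have oT := @openT R.
  by apply: smooth_onDZ => //; exact: smooth_onDZ.
have df t : derivable f t 1 by apply/derivable1_diffP; exact: (sf [::]).
have pos t : 0 < 1 + s * ('D_1 g t - 1).
  have := pg t; set d := 'D_1 g t => d0.
  have [->|s10] := eqVneq s 1; first by rewrite mul1r addrC subrK.
  have : 0 < 1 - s by rewrite subr_gt0 lt_neqAle s10.
  have : 0 <= s * d by rewrite mulr_ge0 // ltW.
  lra.
have pf t : 0 < 'D_1 f t.
  have oT := @openT R.
  have -> : f = fun t => idfun t + s *: (g t + (- 1) *: idfun t).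
    by apply/funext => u; rewrite /f scaleN1r.
  have sgN := smooth_onDZ (- 1) oT sg sid.
  have := @iter_deriveDZ R R R setT _ _ s [:: 1] oT sid sgN t I.
  have := @iter_deriveDZ R R R setT _ _ (- 1) [:: 1] oT sg sid t I.
  by move=> /= -> ->; rewrite derive_id scaleN1r; exact: pos.
have incf := derivative_gt0_lt df pf.
have fc : continuous f.
  by move=> t; apply: differentiable_continuous; exact/derivable1_diffP.
have surj y : exists t, f t == y.
  have le_g u : u <= g' y -> g u <= y.
    rewrite le_eqVlt => /predU1P[->|/incg]; first by rewrite g'K.
    by rewrite g'K => /ltW.
  have ge_g u : g' y <= u -> y <= g u.
    rewrite le_eqVlt => /predU1P[<-|/incg]; first by rewrite g'K.
    by rewrite g'K => /ltW.
  pose a := Num.min y (g' y); pose b := Num.max y (g' y).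
  have fa : f a <= y.
    have ga : g a <= y by apply: le_g; rewrite ge_min lexx orbT.
    have ay : a <= y by rewrite ge_min lexx.
    rewrite /f -[X in _ + X]/(s * (g a - a)).
    have : 0 <= s * (y - g a) by rewrite mulr_ge0 // subr_ge0.
    have : 0 <= (1 - s) * (y - a) by rewrite mulr_ge0 // subr_ge0.
    lra.
  have fb : y <= f b.
    have gb : y <= g b by apply: ge_g; rewrite le_max lexx orbT.
    have yb : y <= b by rewrite le_max lexx.
    rewrite /f -[X in _ + X]/(s * (g b - b)).
    have : 0 <= s * (g b - y) by rewrite mulr_ge0 // subr_ge0.
    have : 0 <= (1 - s) * (b - y) by rewrite mulr_ge0 // subr_ge0.
    lra.
  have ab : a <= b by rewrite /a ge_min /b le_max lexx.
  have [||c _ <-] := @IVT R f a b y ab; last by exists c.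
  - exact: continuous_subspaceT.
  - by rewrite ge_min fa le_max fb orbT.
pose h y := xchoose (surj y).
have hK : cancel h f by move=> y; apply/eqP; exact: xchooseP (surj y).
have inj : injective f.
  move=> x y xy; by have [/incf|/incf|//] := ltgtP x y; rewrite xy ltxx.
have fK : cancel f h by move=> t; apply: inj; rewrite hK.
split => //; last by move=> t; rewrite derive1E.
by exists h; split => //; exact: smooth_inverse sf pf fK hK.
Qed.

End segment_of_diffeos.

(** * Segments in the fine very strong topology *)

Section segments_of_functions.
Context {R : realType} {n : nat} {M : topologicalType}.
Variable A : set (chart R n M).
Implicit Types (c : chart R n M) (f g h : smooth_fun A) (K C : set M).

Lemma near_finite_set {T I : Type} (F : set_system T) (D : set I)
    (P : T -> I -> Prop) : Filter F -> finite_set D ->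
  (forall i, D i -> \forall t \near F, P t i) ->
  \forall t \near F, forall i, D i -> P t i.
Proof.
move=> FF fD; have /(@finite_seqP {classic I})[s ->] := fD.
elim: s => [_|i s IH Ds]; first by near=> t.
have IHs : \forall t \near F, forall j, [set` s] j -> P t j.
  by apply: IH => j js; apply: Ds; rewrite /= inE; apply/orP; right.
have Pi : \forall t \near F, P t i.
  by apply: Ds; rewrite /= inE eqxx.
apply: filterS2 IHs Pi => t Ps Pi j; rewrite /= inE => /predU1P[->//|].
exact: Ps.
Unshelve. all: by end_near. Qed.

Lemma continuous_subbase (T : topologicalType) (p : T -> smooth_fun A) :
  (forall O, fine_very_strong_subbase O ->
     forall t, O (p t) -> \forall u \near t, O (p u)) ->
  continuous p.
Proof.
move=> pO; apply/continuousP => _ [D' sD' <-]; rewrite openE => t [N DN Nt].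
have [J sJ JN] := sD' _ DN; rewrite /interior.
have HN : \forall u \near t, N (p u).
  rewrite -JN; apply: filter_bigI => j jJ.
  by apply: pO; [exact/set_mem/sJ|rewrite -JN in Nt; exact: Nt].
by apply: filterS HN => u Nu; exists N.
Qed.

Lemma chart_derivative_bounded k c K (w : M -> R) :
  is_topological_chart c -> smooth_on (chart_codom c) (w \o chart_inv c) ->
  compact K -> K `<=` chart_dom c ->
  exists2 B : R, 0 <= B & forall a (v : k.-tuple 'rV[R]_n), K a ->
    (forall i, `|tnth v i| <= 1) -> `|chart_derivative w c a v| <= B.
Proof.
move=> [_ oc _ cc _] sw cK Kc.
have ccK : compact (c @` K).
  by apply: continuous_compact => //; exact: continuous_subspaceW cc.
have [|B B0 HB] := iter_derive_bounded k oc ccK _ sw.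
  by move=> _ [a /Kc ca <-]; exists a.
exists B => // a v Ka v1; apply: HB; first by exists a.
- by rewrite size_tuple.
- by move=> _ /tnthP[i ->].
Qed.

(** [C] being closed, [w] vanishes in a neighbourhood of each point outside
    [C], so its derivatives vanish there as well. *)
Lemma chart_derivative_eq0 k c C (w : M -> R) :
  is_topological_chart c -> closed C -> (forall x, ~ C x -> w x = 0) ->
  forall a (v : k.-tuple 'rV[R]_n), chart_dom c a -> ~ C a ->
  chart_derivative w c a v = 0.
Proof.
move=> tc clC w0 a v ca Ca.
have oU : open (c @` (chart_dom c `&` ~` C)).
  apply: (open_chart_image (d := Chart (~` C) c (chart_inv c))) => //=.
  exact: closed_openC.
rewrite /chart_derivative.
rewrite (eq_iter_derive (g := cst 0) v oU) ?iter_derive0 //; last by exists a.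
move=> _ [b [cb Cb] <-] /=; have [_ _ cK _ _] := tc.
by rewrite cK ?inE // w0.
Qed.

Lemma is_smooth_segment f g (s : R) :
  is_smooth A (fun x => f x + s *: (g x - f x)).
Proof.
move=> c mc; have [[_ oc _ _ _] _] := mc.
have sf := smooth_funP f mc; have sg := smooth_funP g mc.
have -> : (fun x => f x + s *: (g x - f x)) \o chart_inv c =
    fun y => (f \o chart_inv c) y + s *: ((g \o chart_inv c) y
      + (- 1) *: (f \o chart_inv c) y).
  by apply/funext => y /=; rewrite scaleN1r.
by apply: smooth_onDZ => //; exact: smooth_onDZ.
Qed.

Definition segment f g (s : R) : smooth_fun A :=
  SmoothFun (is_smooth_segment f g s).

Lemma smooth_on_sub f g c : maximal_atlas A c ->
  smooth_on (chart_codom c) ((fun x => g x - f x) \o chart_inv c).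
Proof.
move=> mc; have [[_ oc _ _ _] _] := mc.
have -> : (fun x => g x - f x) \o chart_inv c =
    fun y => (g \o chart_inv c) y + (- 1) *: (f \o chart_inv c) y.
  by apply/funext => y /=; rewrite scaleN1r.
by apply: smooth_onDZ => //; exact: smooth_funP.
Qed.

Lemma chart_derivative_segment f g c k (a : M) (v : k.-tuple 'rV[R]_n) s :
  maximal_atlas A c -> chart_dom c a ->
  chart_derivative (segment f g s) c a v =
  chart_derivative f c a v + s * chart_derivative (fun x => g x - f x) c a v.
Proof.
move=> mc ca; have [[_ oc _ _ _] _] := mc; rewrite /chart_derivative.
rewrite -(@iter_deriveDZ _ _ _ (chart_codom c) _ _ s v oc) //.
- exact: smooth_funP.
- exact: smooth_on_sub.
- by exists a.
Qed.

Lemma chart_dist_leP k c K (h1 h2 : M -> R) (b : R) :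
  (chart_dist k c K h1 h2 <= b%:E)%E <->
  forall a (v : k.-tuple 'rV[R]_n), K a -> (forall i, `|tnth v i| <= 1) ->
    `|chart_derivative h1 c a v - chart_derivative h2 c a v| <= b.
Proof.
split=> [H a v Ka v1|H].
  rewrite -lee_fin; apply: le_trans H.
  apply: (@le_trans _ _ (multilinear_norm (fun v : k.-tuple 'rV[R]_n =>
      chart_derivative h1 c a v - chart_derivative h2 c a v))).
    by apply: ereal_sup_ubound; exists v.
  by apply: ereal_sup_ubound; exists a.
apply: ge_ereal_sup => _ [a Ka <-]; apply: ge_ereal_sup => _ [v v1 <-].
by rewrite lee_fin; exact: H.
Qed.

(** Passing from [s0] to [s] changes the derivatives by [s - s0] times those of
    [g - f], which are bounded on the compact set [K]. *)
Lemma chart_dist_segment_near f g h c K k s0 (e : R) :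
  maximal_atlas A c -> compact K -> K `<=` chart_dom c ->
  (chart_dist k c K (segment f g s0) h < e%:E)%E ->
  \forall s \near s0, (chart_dist k c K (segment f g s) h < e%:E)%E.
Proof.
move=> mc cK Kc He; have [tc _] := mc.
have [B B0 HB] := chart_derivative_bounded k tc (smooth_on_sub f g mc) cK Kc.
(* a strict bound on the supremum leaves room for a perturbation *)
have [e' e'e He'] : exists2 e' : R, e' < e &
    (chart_dist k c K (segment f g s0) h <= e'%:E)%E.
  case: (chart_dist _ _ _ _ _) He => [r| |] //.
    by rewrite lte_fin => re; exists r.
  by move=> _; exists (e - 1); rewrite ?leNye // ltrBlDr ltrDl.
have d0 : 0 < (e - e') / 2 / (B + 1).
  by rewrite !divr_gt0 ?subr_gt0 // ltr_wpDl.
near=> s.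
apply: (@le_lt_trans _ _ ((e + e') / 2)%:E); last by rewrite lte_fin; lra.
apply/chart_dist_leP => a v Ka v1; move/chart_dist_leP in He'.
have := He' a v Ka v1; have := HB a v Ka v1.
rewrite !chart_derivative_segment //; try exact: Kc.
set w := chart_derivative (fun _ => _) _ _ _.
set x := chart_derivative f _ _ _; set y := chart_derivative h _ _ _ => wB He0.
have -> : x + s * w - y = (x + s0 * w - y) + (s - s0) * w by ring.
have ss0 : `|s - s0| < (e - e') / 2 / (B + 1).
  by rewrite distrC; near: s; exact: nbhsx_ballx.
apply: (le_trans (ler_normD _ _)); rewrite normrM.
have : `|s - s0| * `|w| <= (e - e') / 2 / (B + 1) * (B + 1).
  by apply: ler_pM => //; rewrite (le_trans wB) // lerDl.
rewrite divfK; last by rewrite gt_eqF // ltr_wpDl.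
lra.
Unshelve. all: by end_near. Qed.

Lemma chart_dist_segment_off f g h c C K k s0 s : hausdorff_space M ->
  maximal_atlas A c -> compact C -> [set x | g x <> f x] `<=` C ->
  K `<=` chart_dom c -> K `&` C = set0 ->
  chart_dist k c K (segment f g s) h = chart_dist k c K (segment f g s0) h.
Proof.
move=> hM mc cC gfC Kc KC; have [tc _] := mc.
have w0 x : ~ C x -> g x - f x = 0.
  by move=> Cx; apply/eqP; rewrite subr_eq0; apply/eqP; apply: contrapT => /gfC.
have clC := compact_closed hM cC.
congr ereal_sup; apply/eq_imagel => a Ka; congr multilinear_norm.
apply/funext => v; rewrite !chart_derivative_segment //; try exact: Kc.
rewrite (chart_derivative_eq0 tc clC w0 v (Kc _ Ka)) ?mulr0 // => Ca.
by have : (K `&` C) a by []; rewrite KC.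
Qed.

(** A point of the compact set [C] has a neighbourhood that meets only finitely
    many [K i], so the conditions indexed by these [i] hold together for [s]
    near [s0]; compactness makes this uniform over [C].  The [K i] disjoint from
    [C] impose the same condition for all [s]. *)
Lemma segment_very_strong_near f g B s0 : hausdorff_space M ->
  compactly_equal_class f g -> very_strong_basis B -> B (segment f g s0) ->
  \forall s \near s0, B (segment f g s).
Proof.
move=> hM [C cC gfC] [h [I [K [phi [r [e [lf cK mK e0 ->]]]]]]] Bs0.
pose good s i := forall k : nat, (k <= r i)%N ->
  (chart_dist k (phi i) (K i) (segment f g s) h < (e i)%:E)%E.
have near_good i : \forall s \near s0, good s i.
  have := @near_finite_set _ _ (nbhs s0) [set k : nat | (k < (r i).+1)%N]
    (fun s k => (chart_dist k (phi i) (K i) (segment f g s) h < (e i)%:E)%E)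
    _ (finite_II _) _.
  apply=> k /= kr; have [mc Kc] := mK i.
  by apply: chart_dist_segment_near => //; exact: Bs0.
have near_C : \forall s \near s0, C `<=` fun x => forall i, K i x -> good s i.
  move/compact_near_coveringP: (cC).
  move=> /(_ R (nbhs s0) (fun s x => forall i, K i x -> good s i)).
  apply => x _.
  have [U Ux fU] := lf x.
  have gU := near_finite_set (nbhs_filter s0) fU (fun i _ => near_good i).
  exists (U, [set s | forall i, K i `&` U !=set0 -> good s i]).
    by split.
  by move=> [y s] /= [Uy gs] i Ky; apply: gs; exists y.
apply: filterS near_C => s gC i.
have [mc Kc] := mK i.
have [KC0|/set0P[x [Kx Cx]]] := eqVneq (K i `&` C) set0; last exact: (gC x).
move=> k kr; rewrite (chart_dist_segment_off h k s0 s hM mc cC gfC Kc) //.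
exact: Bs0.
Qed.

Lemma segment_class f g s : compactly_equal_class f g ->
  compactly_equal_class f (segment f g s).
Proof.
move=> [C cC gfC]; exists C => // x /= H; apply: gfC => /= gf.
by apply: H; rewrite gf subrr scaler0 addr0.
Qed.

Lemma compactly_equal_class_sym f g :
  compactly_equal_class f g -> compactly_equal_class g f.
Proof.
by move=> [C cC H]; exists C => // x /= fg; apply: H => /= gf; apply: fg.
Qed.

Lemma compactly_equal_class_trans f g h : compactly_equal_class f g ->
  compactly_equal_class g h -> compactly_equal_class f h.
Proof.
move=> [C cC H] [D cD H']; exists (C `|` D); first exact: compactU.
move=> x /= hf; have [gf|gf] := pselect (g x = f x).
  by right; apply: H' => /= hg; apply: hf; rewrite hg.
by left; exact: H.
Qed.

(** The other members of the subbase, the classes, contain the whole segment as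
    soon as they contain one of its points. *)
Lemma continuous_segment f g : hausdorff_space M ->
  compactly_equal_class f g -> continuous (segment f g : R -> smooth_fun A).
Proof.
move=> hM fg; apply: continuous_subbase => O [Oo|[h ->]] s Os.
  have [B [bB Bs BO]] := Oo _ Os.
  by apply: filterS (segment_very_strong_near hM fg bB Bs) => u /BO.
near=> u; apply: (compactly_equal_class_trans Os).
apply: compactly_equal_class_trans (segment_class u fg).
exact: compactly_equal_class_sym (segment_class s fg).
Unshelve. all: by end_near. Qed.

Lemma open_compactly_equal_class f : open (compactly_equal_class f).
Proof.
exists [set compactly_equal_class f]; last by rewrite bigcup_set1.
move=> _ ->; apply: finI_from1; right; by exists f.
Qed.

(** The complement is the union of the other classes. *)
Lemma closed_compactly_equal_class f : closed (compactly_equal_class f).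
Proof.
rewrite -openC openE => g fg; rewrite /interior.
apply: filterS (open_nbhs_nbhs (conj (open_compactly_equal_class g) _)).
  move=> h gh fh; apply: fg; apply: compactly_equal_class_trans fh _.
  exact: compactly_equal_class_sym.
by exists set0; [exact: compact0|].
Qed.

End segments_of_functions.

(** * Connectedness of the Lorentz group *)

Section lorentz_connected.
Variable R : realType.
Implicit Types (L : 'M[R]_4) (g : R -> 'M[R]_4).
Local Notation minkowski := (@Defs.minkowski R).

Lemma sum_ord4 (F : 'I_4 -> R) : \sum_i F i = F 0 + F 1 + F 2 + F 3.
Proof.
rewrite !big_ord_recl big_ord0 addr0 !addrA.
by congr (F _ + F _ + F _ + F _); exact: val_inj.
Qed.

Lemma ord4P (P : 'I_4 -> Prop) : P 0 -> P 1 -> P 2 -> P 3 -> forall i, P i.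
Proof.
move=> p0 p1 p2 p3 [[|[|[|[|//]]]] i4].
- by rewrite (_ : Ordinal i4 = 0) //; exact: val_inj.
- by rewrite (_ : Ordinal i4 = 1) //; exact: val_inj.
- by rewrite (_ : Ordinal i4 = 2) //; exact: val_inj.
- by rewrite (_ : Ordinal i4 = 3) //; exact: val_inj.
Qed.

(** The Minkowski product of the columns [k] and [l]. *)
Definition column_form L (k l : 'I_4) : R :=
  L 0 k * L 0 l + L 1 k * L 1 l + L 2 k * L 2 l - L 3 k * L 3 l.

Lemma isometryP L : L^T *m minkowski *m L = minkowski <->
  forall k l, column_form L k l = minkowski k l.
Proof.
have E k l : (L^T *m minkowski *m L) k l = column_form L k l.
  rewrite mxE sum_ord4 !mxE !sum_ord4 !mxE /= /column_form; ring.
split=> [H k l|H]; first by rewrite -E H.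
by apply/matrixP => k l; rewrite E H.
Qed.

Lemma isometry_det L :
  L^T *m minkowski *m L = minkowski -> \det L ^+ 2 = 1.
Proof.
move=> /(congr1 determinant); rewrite !det_mulmx det_tr => H.
have d0 : \det (minkowski) != 0.
  suff -> : minkowski = diag_mx (\row_i minkowski i i).
    rewrite det_diag; apply/prodf_neq0 => i _; rewrite !mxE eqxx.
    by case: ifP => _; rewrite ?oppr_eq0 oner_neq0.
  by apply/matrixP => i j; rewrite !mxE eqxx; case: eqVneq => [->|].
apply: (mulIf d0); rewrite mul1r -[RHS]H; ring.
Qed.

(** The last column has Minkowski square [-1], while a column without time entry
    has a nonnegative one. *)
Lemma isometry_neq0 L : L^T *m minkowski *m L = minkowski -> L 3 3 != 0.
Proof.
move=> /isometryP/(_ 3 3); rewrite /column_form mxE /= => H; apply/eqP => L0.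
move: H; rewrite L0 => H.
have := sqr_ge0 (L 0 3); have := sqr_ge0 (L 1 3); have := sqr_ge0 (L 2 3).
by rewrite !expr2; lra.
Qed.

Lemma continuous_neq0_gt0 (f : R -> R) : continuous f ->
  (forall t, f t != 0) -> 0 < f 0 -> forall t, 0 < f t.
Proof.
move=> fc f0 p t; have [//|nt] := ltP 0 (f t).
have cf (A : set R) : {within A, continuous f} by exact: continuous_subspaceT.
have [t0|t0] := leP t 0.
  have [|c _ c0] := @IVT R f t 0 0 t0 (cf _).
    by rewrite ge_min nt le_max (ltW p) orbT.
  by have := f0 c; rewrite c0 eqxx.
have [|c _ c0] := @IVT R f 0 t 0 (ltW t0) (cf _).
  by rewrite ge_min nt orbT le_max (ltW p).
by have := f0 c; rewrite c0 eqxx.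
Qed.

Lemma continuous_mx m n (T : topologicalType) (g : T -> 'M[R]_(m, n)) :
  (forall i j, continuous (fun t => g t i j)) -> continuous g.
Proof.
move=> gc t U [P Pn PU].
rewrite /nbhs/=; apply: (filterS (P := [set u | forall i j, P i j (g u i j)])).
  by move=> u Pu; exact: PU.
apply: filter_forall => i; apply: filter_forall => j.
exact: (gc i j t _ (Pn i j)).
Qed.

Lemma continuous_det n (g : R -> 'M[R]_n) :
  (forall i j, continuous (fun t => g t i j)) ->
  continuous (fun t => \det (g t)).
Proof.
move=> gc; rewrite /determinant.
apply: (@continuous_big _ _ +%R 0) => [z|s _ t]; first exact: add_continuous.
apply: cvgM; first exact: cvg_cst.
apply: (@cvg_big R _ *%R 1 predT (@mul_continuous R)) => i _.
exact: gc.
Qed.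

(** A relation between matrices rather than elements of the subtype, so that row
    operations can be chained without carrying membership proofs. *)
Definition joined L M := exists l m : lorentz R,
  [/\ \val l = L, \val m = M & connected_component [set: lorentz R] l m].

Lemma joined_trans L M N : joined L M -> joined M N -> joined L N.
Proof.
move=> [l [m [<- <- lm]]] [m' [n [/val_inj -> <- mn]]].
by exists l, n; split => //; exact: connected_component_trans mn.
Qed.

Lemma joined_lorentz L M : joined L M -> lorentz_set R M.
Proof. by move=> [l [m [_ <- _]]]; exact: set_mem (valP m). Qed.

(** Isometries have nonzero determinant and time-time entry; by the
    intermediate value theorem both keep their sign along the path, which
    therefore never leaves the group. *)
Lemma isometry_path_joined g : (forall i j, continuous (fun t => g t i j)) ->
  (forall t k l, column_form (g t) k l = column_form (g 0) k l) ->
  lorentz_set R (g 0) -> forall t, joined (g 0) (g t).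
Proof.
move=> gc gf [g0 d0 p0].
have gi t : (g t)^T *m minkowski *m g t = minkowski.
  by apply/isometryP => k l; rewrite gf; exact: (isometryP _).1 g0 k l.
have gl t : lorentz_set R (g t).
  have dp : 0 < \det (g t).
    apply: (continuous_neq0_gt0 (f := fun t => \det (g t))).
    - exact: continuous_det.
    - move=> u; apply/eqP => u0; have := isometry_det (gi u).
      by rewrite u0 expr0n /= => /esym/eqP; rewrite oner_eq0.
    - by rewrite d0.
  split => //.
  - by apply/eqP; rewrite -(@pexpr_eq1 _ _ 2) ?ltW // isometry_det.
  - apply: (continuous_neq0_gt0 (f := fun t => g t 3 3)) => // u.
    exact: isometry_neq0.
pose G t : lorentz R := exist _ (g t) (mem_set (gl t)).
have Gc : continuous G.
  apply: (@continuous_comp_initial _ _ _ set_val).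
  exact: continuous_mx.
move=> t; exists (G 0), (G t); split => //.
exists (range G) => //; split => //.
apply: connected_continuous_connected; last exact: continuous_subspaceT.
by apply/connected_intervalP => x y _ _ z.
Qed.

(** Left multiplication by the rotation of angle [t] in the plane of the
    coordinates [i] and [j]. *)
Definition rotate (i j : 'I_4) (t : R) L : 'M[R]_4 := \matrix_(k, l)
  if k == i then cos t * L i l - sin t * L j l
  else if k == j then sin t * L i l + cos t * L j l else L k l.

Lemma rotate_joined i j t L : i != j -> i != 3 -> j != 3 ->
  lorentz_set R L -> joined L (rotate i j t L).
Proof.
move=> ij i3 j3 HL.
have r0 : rotate i j 0 L = L.
  apply/matrixP => k l; rewrite mxE cos0 sin0.
  case: eqVneq => [->|_]; first by rewrite mul1r mul0r subr0.
  by case: eqVneq => [->|//]; rewrite mul1r mul0r add0r.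
rewrite -{1}r0; apply: (isometry_path_joined (g := fun t => rotate i j t L)).
- move=> k l.
  have -> : (fun u => rotate i j u L k l) = fun u =>
      if k == i then cos u * L i l - sin u * L j l
      else if k == j then sin u * L i l + cos u * L j l else L k l.
    by apply/funext => u /=; rewrite !mxE.
  have cc (a : R) : continuous (fun u => cos u * a).
    by move=> u; apply: cvgM;
      [exact: continuous_cos|exact: cvg_cst].
  have cs (a : R) : continuous (fun u => sin u * a).
    by move=> u; apply: cvgM;
      [exact: continuous_sin|exact: cvg_cst].
  case: (k == i); first by move=> u; apply: cvgB; [exact: cc|exact: cs].
  case: (k == j); last by move=> u; exact: cvg_cst.
  by move=> u; apply: cvgD; [exact: cs|exact: cc].
- move=> u k l; rewrite r0 /column_form !mxE.
  have su : sin u ^+ 2 = 1 - cos u ^+ 2 by rewrite -(cos2Dsin2 u); ring.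
  move: i j ij i3 j3 {r0}; apply: ord4P; apply: ord4P => //= _ _ _;
    ring: su.
- by rewrite r0.
Qed.

(** The entry to be cleared changes sign between the angles 0 and [pi], so it
    vanishes at some angle; adding [pi] if necessary makes the other entry
    nonnegative. *)
Lemma rotate_kill i j k L : i != j -> i != 3 -> j != 3 -> lorentz_set R L ->
  exists M, [/\ joined L M, M i k = 0, 0 <= M j k,
    forall l, L i l = 0 -> L j l = 0 -> M i l = 0 /\ M j l = 0 &
    forall h l, h != i -> h != j -> M h l = L h l].
Proof.
move=> ij i3 j3 HL.
pose f t := cos t * L i k - sin t * L j k.
have fc : continuous f.
  move=> t; apply: cvgB; apply: cvgM.
  - exact: continuous_cos.
  - exact: cvg_cst.
  - exact: continuous_sin.
  - exact: cvg_cst.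
have [t ft tp] : exists2 t, f t = 0 & 0 <= sin t * L i k + cos t * L j k.
  have [||c _ c0] := @IVT R f 0 pi 0 (pi_ge0 R).
  - exact: continuous_subspaceT.
  - rewrite /f cos0 sin0 cospi sinpi !mul0r !subr0 mul1r mulN1r.
    by rewrite ge_min le_max; have [|/ltW] := leP (L i k) 0;
      rewrite ?oppr_ge0 ?oppr_le0 => -> //; rewrite ?orbT.
  - have [cp|/ltW cn] := leP 0 (sin c * L i k + cos c * L j k).
      by exists c.
    exists (c + pi); rewrite /f sinDpi cosDpi !mulNr -?opprD ?oppr_ge0 //.
    by rewrite -/(f c) c0 oppr0.
have ji : (j == i) = false by apply/negbTE; rewrite eq_sym.
exists (rotate i j t L); split.
- exact: rotate_joined.
- by rewrite mxE eqxx.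
- by rewrite mxE ji eqxx.
- by move=> l li lj; rewrite !mxE !eqxx ji li lj !mulr0 subr0 addr0.
- by move=> h l /negbTE hi /negbTE hj; rewrite mxE hi hj.
Qed.

(** Left multiplication by the boost of rapidity [- t] in the plane of the
    coordinates 2 and 3. *)
Definition boost (t : R) L : 'M[R]_4 := \matrix_(k, l)
  if k == 2 then (expR t + expR (- t)) / 2 * L 2 l
                 - (expR t - expR (- t)) / 2 * L 3 l
  else if k == 3 then (expR t + expR (- t)) / 2 * L 3 l
                 - (expR t - expR (- t)) / 2 * L 2 l
  else L k l.

Lemma boost_joined t L : lorentz_set R L -> joined L (boost t L).
Proof.
move=> HL.
have r0 : boost 0 L = L.
  apply/matrixP => k l; rewrite mxE oppr0 expR0.
  case: eqVneq => [->|_]; first by field.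
  by case: eqVneq => [->|//]; field.
rewrite -{1}r0; apply: (isometry_path_joined (g := fun t => boost t L)).
- move=> k l.
  have -> : (fun u => boost u L k l) = fun u =>
     if k == 2 then (expR u + expR (- u)) / 2 * L 2 l
                 - (expR u - expR (- u)) / 2 * L 3 l
     else if k == 3 then (expR u + expR (- u)) / 2 * L 3 l
                 - (expR u - expR (- u)) / 2 * L 2 l
     else L k l.
    by apply/funext => u /=; rewrite !mxE.
  have cN : continuous (fun u : R => expR (- u)).
    move=> u; apply: continuous_comp; first exact: opp_continuous.
    exact: continuous_expR.
  have cc (a : R) : continuous (fun u => (expR u + expR (- u)) / 2 * a).
    move=> u; do 2![apply: cvgM; last exact: cvg_cst].
    by apply: cvgD; [exact: continuous_expR|exact: cN].
  have cs (a : R) : continuous (fun u => (expR u - expR (- u)) / 2 * a).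
    move=> u; do 2![apply: cvgM; last exact: cvg_cst].
    by apply: cvgB; [exact: continuous_expR|exact: cN].
  case: (k == 2); first by move=> u; apply: cvgB; [exact: cc|exact: cs].
  case: (k == 3); last by move=> u; exact: cvg_cst.
  by move=> u; apply: cvgB; [exact: cc|exact: cs].
- move=> u k l; rewrite r0 /column_form !mxE /= expRN.
  by field; rewrite gt_eqF ?expR_gt0.
- by rewrite r0.
Qed.

(** The last column has Minkowski square [-1], so [z = L 2 3] and [t = L 3 3]
    satisfy [(t + z) * (t - z) = 1] and both factors are positive. *)
Lemma boost_kill L : lorentz_set R L -> L 0 3 = 0 -> L 1 3 = 0 ->
  exists M, [/\ joined L M, M 2 3 = 0 &
    forall h l, h != 2 -> h != 3 -> M h l = L h l].
Proof.
move=> HL L03 L13.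
have [/isometryP/(_ 3 3) + _ L33] := HL.
rewrite /column_form L03 L13 mxE /= => E.
set z := L 2 3 in E *; set t := L 3 3 in E L33 *.
have pq : 0 < (t + z) * (t - z).
  suff -> : (t + z) * (t - z) = 1 by [].
  by have : t * t - z * z = 1; [lra|move=> <-; ring].
have [p q] : 0 < t + z /\ 0 < t - z.
  have [p|p] := ltP 0 (t + z); first by rewrite (pmulr_rgt0 _ p) in pq.
  have : t - z <= 0.
    by rewrite leNgt; apply/negP => q; rewrite (pmulr_lgt0 _ q) ltNge p in pq.
  lra.
(* z = t * tanh r amounts to exp (2 r) = (t + z) / (t - z) *)
pose r := ln ((t + z) / (t - z)) / 2.
exists (boost r L); split.
- exact: boost_joined.
- rewrite mxE /= -/z -/t.
  have r2 : expR r * expR r * (t - z) = t + z.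
    rewrite -expRD /r -splitr lnK ?divfK ?gt_eqF //.
    by rewrite posrE divr_gt0.
  rewrite expRN; have er := expR_gt0 r.
  have er0 : expR r != 0 by rewrite gt_eqF.
  apply: (mulIf er0); rewrite mul0r.
  suff : (expR r * expR r + 1) * z = (expR r * expR r - 1) * t.
    move=> H.
    transitivity (((expR r * expR r + 1) * z - (expR r * expR r - 1) * t) / 2).
      by field.
    by rewrite H subrr mul0r.
  lra.
- by move=> h l /negbTE h2 /negbTE h3; rewrite mxE h2 h3.
Qed.

Lemma sqr_eq1 (x : R) : 0 <= x -> x * x = 1 -> x = 1.
Proof. by move=> x0 /eqP; rewrite -expr2 pexpr_eq1 // => /eqP. Qed.

(** Two rotations and a boost turn column 3 into a basis vector; orthogonality
    of the columns then clears row 3.  In the same way, rotations clear columns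
    and rows 2 and 1, and the determinant fixes the remaining diagonal entry. *)
Lemma joined_identity L : lorentz_set R L -> joined L 1%:M.
Proof.
move=> HL.
have [M1 [LM1 a1 _ _ _]] := @rotate_kill 0 2 3 L isT isT isT HL.
have [M2 [M12 a2 _ _ f2]] :=
  @rotate_kill 1 2 3 M1 isT isT isT (joined_lorentz LM1).
have [M3 [M23 a3 f3]] := boost_kill (joined_lorentz M12)
  (etrans (f2 0 3 isT isT) a1) a2.
have b03 : M3 0 3 = 0 by rewrite f3 // f2.
have b13 : M3 1 3 = 0 by rewrite f3.
have [i3 _ p3] := joined_lorentz M23; move/isometryP in i3.
have b33 : M3 3 3 = 1.
  apply: sqr_eq1; first exact: ltW.
  by have := i3 3 3; rewrite /column_form b03 b13 a3 mxE /=; lra.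
have b3 l : l != 3 -> M3 3 l = 0.
  move=> l3; have := i3 l 3.
  by rewrite /column_form b03 b13 a3 b33 mxE /= (negbTE l3); lra.
have [M4 [M34 a4 _ z4 f4]] :=
  @rotate_kill 0 2 2 M3 isT isT isT (joined_lorentz M23).
have [c03 c23] := z4 3 b03 a3.
have [M5 [M45 a5 p5 z5 f5]] :=
  @rotate_kill 1 2 2 M4 isT isT isT (joined_lorentz M34).
have [d13 d23] := z5 3 (etrans (f4 1 3 isT isT) b13) c23.
have d03 : M5 0 3 = 0 by rewrite f5.
have d02 : M5 0 2 = 0 by rewrite f5.
have d3 l : M5 3 l = M3 3 l by rewrite f5 // f4.
have [i5 _ _] := joined_lorentz M45; move/isometryP in i5.
have d22 : M5 2 2 = 1.
  apply: sqr_eq1 => //.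
  by have := i5 2 2; rewrite /column_form d02 a5 d3 b3 // mxE /=; lra.
have d2 l : l != 2 -> M5 2 l = 0.
  move=> l2; have := i5 l 2.
  by rewrite /column_form d02 a5 d22 (d3 2) (b3 2) // mxE /= (negbTE l2); lra.
have [M6 [M56 a6 p6 z6 f6]] :=
  @rotate_kill 0 1 1 M5 isT isT isT (joined_lorentz M45).
have [e02 e12] := z6 2 d02 a5.
have [e03 e13] := z6 3 d03 d13.
have e2 l : M6 2 l = M5 2 l by rewrite f6.
have e3 l : M6 3 l = M3 3 l by rewrite f6.
have [i6 det6 _] := joined_lorentz M56; move/isometryP in i6.
have e11 : M6 1 1 = 1.
  apply: sqr_eq1 => //.
  by have := i6 1 1; rewrite /column_form a6 e2 e3 d2 // b3 // mxE /=; lra.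
have e10 : M6 1 0 = 0.
  have := i6 0 1.
  by rewrite /column_form a6 e2 e3 !d2 // !b3 // e11 mxE /=; lra.
have diag6 : M6 = diag_mx (\row_i M6 i i).
  apply/matrixP; apply: ord4P; apply: ord4P; rewrite !mxE //= ?mulr0n;
    by rewrite ?e2 ?e3 ?d2 ?b3.
have e00 : M6 0 0 = 1.
  move: det6; rewrite diag6 det_diag.
  rewrite (bigD1 0) //= big1 ?mulr1 ?mxE //.
  by apply: ord4P; rewrite // mxE ?e2 ?e3.
have M61 : M6 = 1%:M.
  rewrite diag6; apply/matrixP; apply: ord4P; apply: ord4P; rewrite !mxE //=;
    by rewrite ?e2 ?e3.
rewrite -M61; do 5![apply: joined_trans; last eassumption]; exact: LM1.
Qed.

Lemma lorentz_connected : connected [set: lorentz R].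
Proof.
have -> : [set: lorentz R] =
    connected_component [set: lorentz R] (lorentz_unit R).
  apply/seteqP; split => // l _.
  have [l' [u [/val_inj -> uE lu]]] := joined_identity (set_mem (valP l)).
  have -> : lorentz_unit R = u by apply: val_inj; rewrite uE.
  exact: connected_component_sym.
exact: component_connected.
Qed.

End lorentz_connected.

(** * The unit component *)

Section newman_unti_component.
Variable R : realType.

Lemma hausdorff_cylinder : hausdorff_space (cylinder R).
Proof.
have sep (Y : topologicalType) (f : cylinder R -> Y) : hausdorff_space Y ->
    continuous f -> forall p q, cluster (nbhs p) q -> f p = f q.
  move=> hY fc p q pq; apply: hY => B D fpB fqD.
  by have [x [Bx Dx]] := pq _ _ (fc p _ fpB) (fc q _ fqD); exists (f x).
have c1 : continuous (fst : cylinder R -> R) by move=> x; exact: cvg_fst.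
have c2 : continuous (fun x : cylinder R => \val x.2 : 'rV[R]_3).
  move=> x; apply: (@continuous_comp _ _ _ snd (set_val : S2 R -> 'rV[R]_3)).
    exact: cvg_snd.
  exact: initial_continuous.
move=> p q pq; have p1 := sep _ _ (@norm_hausdorff _ _) c1 _ _ pq.
have /val_inj p2 := sep _ _ (@norm_hausdorff _ _) c2 _ _ pq.
by case: p q p1 p2 {pq} => [? ?] [? ?] /= -> ->.
Qed.

Local Notation normal_class :=
  (compactly_equal_class (time R) : set (smooth_cylinder R)).

Lemma nu_normal_cE (F : nu_normal R) :
  nu_normal_c R F <-> normal_class (\val F).
Proof.
split=> -[K cK H]; exists K => // x.
  by move=> /= Fx; apply: contrapT => /H.
by move=> Kx; apply: contrapT => Fx; apply: Kx; exact: H.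
Qed.

Lemma clamp_itv (s : R) : 0 <= Num.max 0 (Num.min 1 s) <= 1.
Proof. by rewrite le_max lexx /= ge_max ler01 ge_min lexx. Qed.

Lemma segment_nu_normal (F : nu_normal R) (s : R) : 0 <= s <= 1 ->
  segment (time R) (\val F) s \in nu_normal_set R.
Proof.
move=> s01; rewrite inE => z.
exact: orientation_diffeo_segment s01 (set_mem (valP F) z).
Qed.

Lemma nu_normal_c_connected (F : nu_normal R) : nu_normal_c R F ->
  connected_component [set: nu_normal R] (nu_normal_unit R) F.
Proof.
move=> /nu_normal_cE cF.
(* clamping the parameter turns the segment into a path over the whole line *)
pose cl (s : R) := Num.max 0 (Num.min 1 s).
pose G s : nu_normal R :=
  exist (fun H => H \in nu_normal_set R) _ (segment_nu_normal F (clamp_itv s)).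
have clc : continuous cl.
  move=> s; apply: continuous_max; first exact: cvg_cst.
  by apply: continuous_min; [exact: cvg_cst|exact: cvg_id].
have Gc : continuous G.
  apply: (@continuous_comp_initial _ _ _ set_val) => s.
  apply: (@continuous_comp _ _ _ cl (segment (time R) (\val F))).
    exact: clc.
  exact: continuous_segment hausdorff_cylinder cF _.
have eqS (f g : smooth_cylinder R) : (forall x, f x = g x) -> f = g.
  case: f g => [f sf] [g sg] /= /funext fg; move: sf sg; rewrite fg => sf sg.
  by congr SmoothFun; exact: Prop_irrelevance.
exists (range G); last first.
  exists 1 => //; apply/val_inj/eqS => x /=.
  by rewrite minxx max_r // scale1r addrC subrK.
split => //.
- exists 0 => //; apply/val_inj/eqS => x /=.
  by rewrite min_r // maxxx scale0r addr0.
- apply: connected_continuous_connected; last exact: continuous_subspaceT.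
  by apply/connected_intervalP => x y _ _ z.
Qed.

End newman_unti_component.

Theorem mainTheorem1 (R : realType) :
  connected_component [set: newman_unti R] (newman_unti_unit R) =
  newman_unti_c R.
Proof.
apply/seteqP; split=> [[F L] [C [Cu _ cC] CF]|[F L] [/= cF _]].
  split => //=; apply/nu_normal_cE.
  have pc : continuous (fun x : newman_unti R => \val x.1 : smooth_cylinder R).
    move=> x; apply: (@continuous_comp _ _ _ fst (set_val : nu_normal R -> _)).
      exact: cvg_fst.
    exact: initial_continuous.
  pose U := (fun x : newman_unti R => \val x.1 : smooth_cylinder R) @^-1`
    compactly_equal_class (time R).
  have CU : C `&` U = C.
    apply: cC.
    - exists (newman_unti_unit R); split => //=.
      by exists set0; [exact: compact0|].
    - exists U => //; apply: open_comp; first by move=> x _; exact: pc.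
      exact: open_compactly_equal_class.
    - exists U => //; apply: closed_comp; first by move=> x _; exact: pc.
      exact: closed_compactly_equal_class.
  by have [] : (C `&` U) (F, L) by rewrite CU.
apply: (@connected_component_trans _ _ (F, lorentz_unit R)).
  have [C [Cu _ cC] CF] := nu_normal_c_connected cF.
  exists ((fun G : nu_normal R => (G, lorentz_unit R)) @` C); last by exists F.
  split => //; first by exists (nu_normal_unit R).
  apply: connected_continuous_connected => //; apply: continuous_subspaceT => G.
  apply: (@cvg_pair _ _ _ (nbhs G) (nbhs G) (nbhs (lorentz_unit R))
    _ _ _ idfun).
    exact: cvg_id.
  exact: cvg_cst.
exists ((fun l : lorentz R => (F, l)) @` setT); last by exists L.
split => //.
apply: connected_continuous_connected; first exact: lorentz_connected.
apply: continuous_subspaceT => l.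
apply: (@cvg_pair _ _ _ (nbhs l) (nbhs F) (nbhs l) _ _ _ (fun=> F)).
  exact: cvg_cst.
exact: cvg_id.
Qed.
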